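(* Let $f,g$ be probability densities on $\mathbb{R}$ such that $f\in\mathcal{L}\cap\mathcal{D}$ and $g(x)=o(f(x))$ as $x\to\infty$. Then: (i) $f\in\mathcal{S}$ if and only if $f*g\in\mathcal{S}$. (ii) Assume that $$\int_{\alpha(x)}^{x-\alpha(x)}f(x-y)g(y)\,dy=o(f(x))\quad\text{as }x\to\infty$$ for a function $\alpha(x)$ such that $\alpha(x)<x/2$, $\alpha(x)\to\infty$ as $x\to\infty$, and $f$ is $\alpha$-insensitive. Then $f\in\mathcal{L}\setminus\mathcal{S}$ if and only if $f*g\in\mathcal{L}\setminus\mathcal{S}$.
   Context: For non-negative functions, $\alpha(x)\sim\beta(x)$ means $\lim_{x\to\infty}\alpha(x)/\beta(x)=1$. For probability densities $f,g$ on $\mathbb{R}$, $f*g(x)=\int_{-\infty}^{\infty}f(x-y)g(y)\,dy$ and $f^{*2}=f*f$. A non-negative measurable function $f$ on $\mathbb{R}$ is long-tailed, $f\in\mathcal{L}$, if $\lim_{x\to\infty}f(x-y)/f(x)=1$ for every $y\in\mathbb{R}$. A probability density $f$ on $\mathbb{R}$ is subexponential, $f\in\mathcal{S}$, if $f\in\mathcal{L}$ and $f^{*2}(x)\sim 2f(x)$ as $x\to\infty$. A function $\alpha:\mathbb{R}\to[0,\infty)$ is almost decreasing, $\alpha\in\mathcal{D}$, if there exist $x_0>0$ and $K>0$ such that $\alpha(x+y)\le K\alpha(x)$ for all $x>x_0$ and $y>0$. A function $f$ is $\alpha$-insensitive if $f(x+y)\sim f(x)$ as $x\to\infty$ uniformly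 in $|y|\le\alpha(x)$, i.e. $\sup_{|y|\le\alpha(x)}|f(x+y)-f(x)|=o(f(x))$ as $x\to\infty$. *)

(* Defs.v *)
From HB Require Import structures.
From mathcomp Require Import all_boot all_order all_algebra.
From mathcomp Require Import all_classical all_reals all_analysis.

Set Implicit Arguments.
Unset Strict Implicit.
Unset Printing Implicit Defensive.

Import Order.TTheory GRing.Theory Num.Theory.
Import numFieldNormedType.Exports.

Local Open Scope classical_set_scope.
Local Open Scope ring_scope.

(* Lets the Landau notation [g =o_+oo f] find that +oo is a filter. *)
Canonical pinfty_filter_on (R : numFieldType) :=
  FilterType (pinfty_nbhs R) (@proper_pinfty_nbhs R).

(* Division is total: if b vanishes at arbitrarily large x, the ratio is 0
   there, so the limit cannot be 1; thus b is eventually nonzero. *)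
Definition asymp_equiv (R : realType) (a b : R -> R) : Prop :=
  a x / b x @[x --> +oo] --> (1 : R).

Definition prob_density (R : realType) (f : R -> R) : Prop :=
  [/\ measurable_fun setT f,
      (forall x, 0 <= f x) &
      (\int[lebesgue_measure]_(x in setT) (f x)%:E = 1)%E].

(* The convolution of two densities can be +oo at some points, necessarily in
   a Lebesgue-null set; the real-valued integral is 0 at those points. *)
Definition convolution (R : realType) (f g : R -> R) : R -> R :=
  fun x => \int[lebesgue_measure]_(y in setT) (f (x - y) * g y).

Definition long_tailed (R : realType) (f : R -> R) : Prop :=
  [/\ measurable_fun setT f,
      (forall x, 0 <= f x) &
      (forall y : R, f (x - y) / f x @[x --> +oo] --> (1 : R))].

Definition subexponential (R : realType) (f : R -> R) : Prop :=
  [/\ prob_density f,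
      long_tailed f &
      asymp_equiv (convolution f f) (fun x => 2 * f x)].

Definition almost_decreasing (R : realType) (a : R -> R) : Prop :=
  (forall x, 0 <= a x) /\
  (exists x0 K : R, [/\ 0 < x0, 0 < K &
     forall x y : R, x0 < x -> 0 < y -> a (x + y) <= K * a x]).

(* The supremum is taken in \bar R: it may be +oo, and the real-valued [sup]
   of an unbounded set is 0. *)
Definition insensitive (R : realType) (a f : R -> R) : Prop :=
  forall e : R, 0 < e -> \forall x \near +oo,
    (ereal_sup [set (`|f (x + y) - f x|%R)%:E | y in [set y : R | (`|y| <= a x)%R]]
       <= (e * f x)%:E)%E.

(* Main.v *)
Require Import Defs.
From HB Require Import structures.
From mathcomp Require Import all_boot all_order all_algebra.
From mathcomp Require Import all_classical all_reals all_analysis.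
From mathcomp Require Import measurable_realfun.
From mathcomp Require Import ring lra.

Set Implicit Arguments.
Unset Strict Implicit.
Unset Printing Implicit Defensive.

Import Order.TTheory GRing.Theory Num.Theory.
Import numFieldNormedType.Exports.

Local Open Scope classical_set_scope.
Local Open Scope ring_scope.

(** Everything rests on where the mass of a convolution at a large point [x]
    comes from.  For [x > 2A], cutting the line at [A] and [x - A] and
    reflecting the rightmost piece gives ([conv_split])
      [(f * g)(x) = \int_{y <= A} f(x - y) g(y) dy
                    + \int_{A < y < x - A} f(x - y) g(y) dy
                    + \int_{y <= A} g(x - y) f(y) dy].
    Long-tailedness controls the outer pieces.  By dominated convergence
    applied to [f(x - y) / f(x)] capped at a constant, the first piece is
    eventually at least [c f(x)] for any [c] below the mass of [g] on the left
    half-line ([long_tailed_conv_ge]); when [f] is almost decreasing a suitable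
    cap is eventually never exceeded on that half-line, so the matching upper
    bound holds too ([long_tailed_conv_le]).  When [g = o(f)] the third piece is [o(f)].

    Two facts follow.  First, subexponentiality of [f] says exactly that the
    middle piece of [f * f] is negligible, that is, an arbitrarily small
    fraction of [f(x)] for all large [x], for a suitable [A]: [subexponential_middle] for any subexponential density,
    [middle_subexponential] for the converse under almost decrease.  Second,
    [f * g ~ f] as soon as the middle piece of [f * g] is negligible
    ([negligible_middle_asymp]).  Since the middle piece only involves values of
    both densities far to the right, its negligibility passes to eventually
    dominated densities ([negligible_middle_dom]), hence subexponentiality
    passes to any asymptotically equivalent density that is long-tailed and
    almost decreasing ([asymp_equiv_subexponential]).

    If [f] is subexponential, [g <= f] eventually makes the middle piece of
    [f * g] negligible, so [f * g ~ f] is subexponential.  Conversely, let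
    [h = f * g] be subexponential.  The lower bound gives [f <= 2h] eventually,
    so the middle piece of [f * g] is negligible relative to [h]; feeding this
    back in the splitting gives [h <= 3f], thus negligibility relative to [f],
    and [h ~ f].  For part (ii), the assumption on [\alpha] and insensitivity
    make the middle piece of [f * g] negligible
    ([insensitive_negligible_middle]), so [f * g ~ f] is long-tailed, and part
    (i) settles subexponentiality.

    The estimates are made on the extended-real integral [convE]: the
    real-valued convolution is [0] where the integral diverges, so upper bounds
    on it would be meaningless before finiteness is known. *)

(** * Convolution of densities *)

(** The convolution integral over a part of the line, kept in the extended
    reals so that divergence remains visible. *)
Definition convE {R : realType} (D : set R) (f g : R -> R) (x : R) : \bar R :=
  (\int[lebesgue_measure]_(y in D) (f (x - y) * g y)%:E)%E.

Section reflection.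
Context {R : realType}.
Implicit Types (f g : R -> R) (D : set R).
Local Notation mu := (@lebesgue_measure R).
Local Notation refl x := (fun y : R => x - y).

Lemma measurable_refl (x : R) : measurable_fun setT (refl x).
Proof. by apply: measurable_funB. Qed.

Lemma lebesgue_measure_refl (x : R) D : measurable D ->
  pushforward mu (refl x : _ -> measurableTypeR R) D = mu D.
Proof.
have mr : measurable_fun setT (refl x : measurableTypeR R -> measurableTypeR R).
  exact: measurable_refl.
move=> mD; apply/esym/lebesgue_measure_unique => //= _ [[a b]] _ <-.
rewrite /pushforward.
have -> : refl x @^-1` [set` `]a, b]] = [set` `[x - b, x - a[].
  by apply/seteqP; split => y /=; rewrite !in_itv/=; lra.
rewrite !lebesgue_measure_itv/= !lte_fin ltrD2l ltrN2.
by case: ifP => // _; congr (_%:E); ring.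
Qed.

Lemma ge0_integral_refl (x : R) D (h : R -> \bar R) : measurable D ->
  measurable_fun D h -> (forall y, D y -> (0 <= h y)%E) ->
  (\int[mu]_(y in refl x @^-1` D) h (x - y)%R = \int[mu]_(y in D) h y)%E.
Proof.
move=> mD mh h0.
have mr : measurable_fun setT (refl x : measurableTypeR R -> measurableTypeR R).
  exact: measurable_refl.
rewrite -[LHS](ge0_integral_pushforward mr)//; last first.
  by move=> y /[!inE]; exact: h0.
by apply: eq_measure_integral => //= A mA AD; rewrite lebesgue_measure_refl.
Qed.

Lemma measurable_conv_integrand D f g (x : R) : measurable_fun setT f ->
  measurable_fun setT g -> measurable_fun D (fun y => (f (x - y) * g y)%:E).
Proof.
move=> mf mg; apply/measurable_EFinP/measurable_funTS/measurable_funM => //.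
by apply: measurableT_comp => //; exact: measurable_refl.
Qed.

(** Commutativity of convolution, localized: the change of variable
    [y := x - y] exchanges the two factors and reflects the domain. *)
Lemma convEC D f g (x : R) : measurable D ->
  measurable_fun setT f -> measurable_fun setT g ->
  (forall y, 0 <= f y) -> (forall y, 0 <= g y) ->
  convE (refl x @^-1` D) f g x = convE D g f x.
Proof.
move=> mD mf mg f0 g0; rewrite /convE.
rewrite -(@ge0_integral_refl x D (fun y => (g (x - y) * f y)%:E))//; first last.
- by move=> y _; rewrite lee_fin mulr_ge0.
- exact: measurable_conv_integrand.
by apply: eq_integral => y _; rewrite subKr mulrC.
Qed.

Lemma convE_ge0 D f g (x : R) : (forall y, 0 <= f y) -> (forall y, 0 <= g y) ->
  (0 <= convE D f g x)%E.
Proof. by move=> f0 g0; apply: integral_ge0 => y _; rewrite lee_fin mulr_ge0. Qed.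

End reflection.

Section density.
Context {R : realType}.
Implicit Types (f g : R -> R) (D : set R).
Local Notation mu := (@lebesgue_measure R).

Lemma density_integrable f D : prob_density f -> measurable D ->
  mu.-integrable D (EFin \o f).
Proof.
move=> [mf f0 f1] mD; apply: (integrableS measurableT) => //.
apply/integrableP; split; first exact/measurable_EFinP.
under eq_integral do rewrite /= ger0_norm//.
by rewrite f1 ltry.
Qed.

Lemma density_mass_le1 f D : prob_density f -> measurable D ->
  (\int[mu]_(y in D) (f y)%:E <= 1)%E.
Proof.
move=> [mf f0 <-] mD; apply: ge0_subset_integral => //.
- exact/measurable_EFinP.
- by move=> y _; rewrite lee_fin.
Qed.

(** The left half-lines exhaust the line, so monotone convergence applies. *)
Lemma density_mass_near1 f (e : R) : prob_density f -> 0 < e ->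
  exists A0 : R, forall A, A0 <= A ->
    ((1 - e)%:E < \int[mu]_(y in `]-oo, A]) (f y)%:E)%E.
Proof.
move=> [mf f0 f1] e0.
have nd : nondecreasing_seq (fun n : nat => `]-oo, n%:R : R]%classic).
  move=> m n mn; rewrite subsetEset => y /=; rewrite !in_itv/= => /le_trans; apply.
  by rewrite ler_nat.
have : (\int[mu]_(y in `]-oo, n%:R]) (f y)%:E @[n --> \oo] -->
    \int[mu]_(y in \bigcup_n `]-oo, n%:R : R]%classic) (f y)%:E)%E.
  apply: ge0_nondecreasing_set_cvg_integral => //.
  - by move=> n; exact/measurable_EFinP/measurable_funTS.
  - by move=> n y _; rewrite lee_fin.
have -> : \bigcup_n `]-oo, n%:R : R]%classic = setT.
  rewrite -subTset => y _; exists (Num.bound `|y|) => //=.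
  by rewrite in_itv/= (le_trans (ler_norm _))// ltW// archi_boundP.
rewrite f1 => h.
have /h[N _ HN] : nbhs (1%:E : \bar R) [set z | (1 - e)%:E < z]%E.
  apply: open_nbhs_nbhs; split; first exact: open_ereal_gt_ereal.
  by rewrite /= lte_fin; lra.
exists N%:R => A NA; apply: (lt_le_trans (HN N (leqnn N))).
apply: ge0_subset_integral => //.
- by apply/measurable_EFinP/measurable_funTS.
- by move=> y _; rewrite lee_fin.
- by move=> y /=; rewrite !in_itv/= => /le_trans; apply.
Qed.

Lemma measurable_convE f g : measurable_fun setT f -> measurable_fun setT g ->
  (forall y, 0 <= f y) -> (forall y, 0 <= g y) ->
  measurable_fun setT (convE setT f g).
Proof.
move=> mf mg f0 g0.
pose F (z : R * R) := (f (z.1 - z.2) * g z.2)%:E.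
apply: (@measurable_fun_fubini_tonelli_F _ _ _ _ _ mu F).
- apply/measurable_EFinP/measurable_funM; apply: measurableT_comp => //.
  exact: measurable_funB.
- by move=> z; rewrite lee_fin mulr_ge0.
Qed.

(** Tonelli: for fixed [y], the integral of [f (x - y)] in [x] is [1] by
    translation invariance. *)
Lemma integral_convE f g : prob_density f -> prob_density g ->
  (\int[mu]_x convE setT f g x = 1)%E.
Proof.
move=> [mf f0 f1] [mg g0 g1].
pose F (z : R * R) := (f (z.1 - z.2) * g z.2)%:E.
rewrite /convE (@fubini_tonelli _ _ _ _ _ mu mu F)//=; last 2 first.
- apply/measurable_EFinP/measurable_funM; apply: measurableT_comp => //.
  exact: measurable_funB.
- by move=> z; rewrite lee_fin mulr_ge0.
rewrite -[RHS]g1; apply: eq_integral => y _; rewrite /F/=.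
under eq_integral do rewrite mulrC EFinM.
rewrite ge0_integralZl//; first last.
- by rewrite lee_fin.
- by move=> x _; rewrite lee_fin.
- by apply/measurable_EFinP; apply: measurableT_comp => //; exact: measurable_funB.
have -> : (\int[mu]_x (f (x - y))%:E = 1)%E; last by rewrite mule1.
have mfy : measurable_fun setT (fun x : R => (f (x - (y : R)))%:E).
  by apply/measurable_EFinP; apply: measurableT_comp => //; exact: measurable_funB.
(* A translation is the composite of two reflections. *)
rewrite -(ge0_integral_refl 0 measurableT mfy) => [|x _]; last by rewrite lee_fin.
rewrite -f1 -(ge0_integral_refl (- (y : R)) measurableT).
- rewrite !preimage_setT; apply: eq_integral => x _.
  by rewrite sub0r opprB opprK addrK.
- apply/measurable_EFinP; apply: measurableT_comp => //.
  by apply: measurable_funB => //; exact: measurable_refl.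
- by move=> x _; rewrite lee_fin.
Qed.

(** The convolution integral has finite total mass, hence is finite almost
    everywhere; replacing it by [0] elsewhere changes no integral. *)
Lemma convolution_density f g : prob_density f -> prob_density g ->
  prob_density (convolution f g).
Proof.
move=> df dg; have := integral_convE df dg.
move: df dg => [mf f0 _] [mg g0 _] I1.
have mc := measurable_convE mf mg f0 g0.
split.
- exact: (measurableT_comp (@fine_measurable R setT measurableT)).
- by move=> x; apply: Rintegral_ge0 => y _; rewrite mulr_ge0.
- rewrite -I1; apply: ge0_ae_eq_integral => //.
  + exact/measurable_EFinP/(measurableT_comp (@fine_measurable R setT measurableT)).
  + by move=> x _; rewrite lee_fin fine_ge0// convE_ge0.
  + by move=> x _; rewrite convE_ge0.
  + have ic : mu.-integrable setT (convE setT f g).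
      apply/integrableP; split => //.
      under eq_integral do rewrite gee0_abs ?convE_ge0//.
      by rewrite I1 ltry.
    apply: filterS (integrable_ae measurableT ic) => x /(_ I) xfin _.
    by rewrite fineK.
Qed.

End density.

(** * The contribution of a fixed left half-line *)

Section long_tails.
Context {R : realType}.
Implicit Types (f g p : R -> R) (D : set R) (A C c e x : R).
Local Notation mu := (@lebesgue_measure R).

Lemma near_gt (a : R) : \forall x \near +oo, a < x.
Proof. by apply: nbhs_pinfty_gt; rewrite num_real. Qed.

(** If [f x = 0] then [f x / f x] is [0], which is far from the limit [1]. *)
Lemma long_tailed_gt0 f : long_tailed f -> \forall x \near +oo, 0 < f x.
Proof.
move=> [_ f0 /(_ 0) fL]; near=> x.
have : f (x - 0) / f x != 0 by near: x; exact: (cvgr_neq0 _ fL (oner_neq0 R)).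
by rewrite lt0r f0 andbT; apply: contra_neq => fx0; rewrite subr0 fx0 mul0r.
Unshelve. all: by end_near. Qed.

(** The cap [C] provides the dominating function [C * p] that the bare ratio
    lacks.  A cap above [1] does not affect the pointwise limit. *)
Definition trunc_ratio f C x y := Num.min (f (x - y) / f x) C.

Lemma trunc_ratio_itv f C x y : (forall z, 0 <= f z) -> 1 < C ->
  0 <= trunc_ratio f C x y <= C.
Proof.
move=> f0 C1; rewrite le_min ge_min lexx orbT andbT divr_ge0//=; lra.
Qed.

Lemma measurable_trunc_integrand f p D C x : measurable_fun setT f ->
  measurable_fun setT p ->
  measurable_fun D (fun y => (trunc_ratio f C x y * p y)%:E).
Proof.
move=> mf mp; apply/measurable_EFinP/measurable_funTS/measurable_funM => //.
apply: measurable_minr => //; apply: measurable_funM => //.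
by apply: measurableT_comp => //; exact: measurable_refl.
Qed.

Lemma integrable_trunc_integrand f p D C x : measurable_fun setT f ->
  (forall z, 0 <= f z) -> measurable_fun setT p -> (forall y, 0 <= p y) ->
  mu.-integrable D (EFin \o p) -> measurable D -> 1 < C ->
  mu.-integrable D (fun y => (trunc_ratio f C x y * p y)%:E).
Proof.
move=> mf f0 mp p0 ip mD C1.
have ig : mu.-integrable D (fun y => C%:E * (p y)%:E)%E by exact: integrableZl.
apply: (@le_integrable _ _ _ mu D mD _ _ _ _ ig).
  exact: measurable_trunc_integrand.
move=> y _; have /andP[? ?] := trunc_ratio_itv x y f0 C1.
rewrite /= lee_fin !normrM (ger0_norm (p0 _)) ler_wpM2r//.
by rewrite !ger0_norm//; lra.
Qed.

(** Dominated convergence with dominating function [C * p], along an arbitrary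
    sequence tending to infinity. *)
Lemma trunc_ratio_cvg f p D C : long_tailed f ->
  measurable_fun setT p -> (forall y, 0 <= p y) ->
  mu.-integrable D (EFin \o p) -> measurable D -> 1 < C ->
  \int[mu]_(y in D) (trunc_ratio f C x y * p y) @[x --> +oo] -->
  \int[mu]_(y in D) p y.
Proof.
move=> [mf f0 fL] mp p0 ip mD C1; apply/cvg_pinftyP => u uoo.
pose F n y := (trunc_ratio f C (u n) y * p y)%:E.
have mF n : measurable_fun D (F n) by exact: measurable_trunc_integrand.
have ig : mu.-integrable D (fun y => C%:E * (p y)%:E)%E.
  exact: integrableZl.
have [||_ _ cF] := @dominated_convergence _ _ _ mu D mD F
    (EFin \o p) _ mF (measurable_int mu ip) _ ig _.
- apply: nearW => y _ /=; apply: cvg_EFin; first by near=> n.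
  rewrite -[X in _ --> X]mul1r; apply: cvgM; last exact: cvg_cst.
  have fu : f (u n - y) / f (u n) @[n --> \oo] --> (1 : R).
    exact: (cvg_comp _ _ uoo (fL y)).
  apply: (cvg_trans _ fu); apply: near_eq_cvg.
  near=> n; rewrite /trunc_ratio min_l//; apply: ltW.
  by near: n; exact: (cvgr_lt _ fu _ C1).
- apply: nearW => y n _ /=.
  have /andP[m0 mC] := trunc_ratio_itv (u n) y f0 C1.
  by rewrite lee_fin ger0_norm ?mulr_ge0// ler_wpM2r.
apply: (@fine_cvg _ _ _ _ (fun n => \int[mu]_(y in D) F n y)%E).
by rewrite fineK//; exact: integrable_fin_num.
Unshelve. all: by end_near. Qed.

Lemma scaled_trunc_integral f p D C x : measurable_fun setT f ->
  (forall z, 0 <= f z) -> measurable_fun setT p -> (forall y, 0 <= p y) ->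
  mu.-integrable D (EFin \o p) -> measurable D -> 1 < C ->
  ((\int[mu]_(y in D) (trunc_ratio f C x y * p y) * f x)%:E =
   \int[mu]_(y in D) (f x * trunc_ratio f C x y * p y)%:E)%E.
Proof.
move=> mf f0 mp p0 ip mD C1.
rewrite EFinM fineK; last first.
  by apply: integrable_fin_num => //; exact: integrable_trunc_integrand.
rewrite muleC -ge0_integralZl//; first by under eq_integral do rewrite -EFinM mulrA.
- exact: measurable_trunc_integrand.
- move=> y _; have /andP[? ?] := trunc_ratio_itv x y f0 C1.
  by rewrite lee_fin mulr_ge0.
- by rewrite lee_fin.
Qed.

(** Fatou's inequality for [f (x - y) / f x]: capping the ratio only decreases
    the integral, and the capped integral converges. *)
Lemma long_tailed_conv_ge f p D c : long_tailed f ->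
  measurable_fun setT p -> (forall y, 0 <= p y) ->
  mu.-integrable D (EFin \o p) -> measurable D ->
  (c%:E < \int[mu]_(y in D) (p y)%:E)%E ->
  \forall x \near +oo, ((c * f x)%:E <= convE D f p x)%E.
Proof.
move=> fL mp p0 ip mD cp; have [mf f0 _] := fL.
have cv := trunc_ratio_cvg fL mp p0 ip mD (ltr1n R 2).
have {}cp : c < \int[mu]_(y in D) p y.
  by rewrite -lte_fin fineK//; exact: integrable_fin_num.
near=> x.
have fx : 0 < f x by near: x; exact: long_tailed_gt0.
have cx : c < \int[mu]_(y in D) (trunc_ratio f 2 x y * p y).
  by near: x; exact: (cvgr_gt _ cv).
apply: (@le_trans _ _ (\int[mu]_(y in D) (trunc_ratio f 2 x y * p y) * f x)%:E).
  by rewrite lee_fin ler_wpM2r// ltW.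
rewrite scaled_trunc_integral ?ltr1n//; apply: ge0_le_integral => //.
- move=> y _; have /andP[? ?] := trunc_ratio_itv x y f0 (ltr1n R 2).
  by rewrite lee_fin !mulr_ge0.
- under eq_fun do rewrite -mulrA EFinM.
  by apply: measurable_funeM; exact: measurable_trunc_integrand.
- exact: measurable_conv_integrand.
- move=> y _; rewrite lee_fin ler_wpM2r// mulrC -ler_pdivlMr//.
  by rewrite ge_min lexx.
Unshelve. all: by end_near. Qed.

(** Long-tailedness bounds [f (x - A)] by [2 * f x], and almost decrease then
    bounds [f] everywhere to the right of [x - A]. *)
Lemma long_tailed_left_bound f A : long_tailed f -> almost_decreasing f ->
  exists2 C, 1 < C &
    \forall x \near +oo, forall y, y <= A -> f (x - y) <= C * f x.
Proof.
move=> fL [_ [x0 [K [_ K0 fK]]]]; have [mf f0 fl] := fL.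
(* [K + 1] rather than [K] makes the constant exceed [1] and covers [y = A]. *)
exists (2 * (K + 1)); first lra.
near=> x => y yA.
have fx : 0 < f x by near: x; exact: long_tailed_gt0.
have fA : f (x - A) <= 2 * f x.
  rewrite -ler_pdivrMr//; apply: ltW.
  by near: x; apply: (cvgr_lt _ (fl A)); rewrite ltr1n.
have [yA'|<-] : y < A \/ A = y by rewrite le_eqVlt in yA; case/orP: yA => [/eqP|]; auto.
  have -> : x - y = (x - A) + (A - y) by ring.
  have := fK (x - A) (A - y) _ _.
  have xA : x0 < x - A by rewrite ltrBrDr; near: x; exact: near_gt.
  move=> /(_ xA ltac:(lra)) h; nra.
nra.
Unshelve. all: by end_near. Qed.

(** With the cap of [long_tailed_left_bound], the capped ratio is eventually
    the ratio itself on the whole half-line, so the integral converges. *)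
Lemma long_tailed_conv_le f p A c : long_tailed f -> almost_decreasing f ->
  prob_density p ->
  (\int[mu]_(y in `]-oo, A]) (p y)%:E < c%:E)%E ->
  \forall x \near +oo, (convE `]-oo, A] f p x <= (c * f x)%:E)%E.
Proof.
move=> fL fD dp cp; have [mf f0 _] := fL; have [mp p0 _] := dp.
have [C C1 fC] := long_tailed_left_bound A fL fD.
have mD : measurable (`]-oo, A] : set R) by exact: measurable_itv.
have ip := density_integrable dp mD.
have cv := trunc_ratio_cvg fL mp p0 ip mD C1.
have {}cp : \int[mu]_(y in `]-oo, A]) p y < c.
  by rewrite -lte_fin fineK//; exact: integrable_fin_num.
near=> x.
have fx : 0 < f x by near: x; exact: long_tailed_gt0.
have cx : \int[mu]_(y in `]-oo, A]) (trunc_ratio f C x y * p y) < c.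
  by near: x; exact: (cvgr_lt _ cv).
have fCx : forall y, y <= A -> f (x - y) <= C * f x by near: x.
have -> : convE `]-oo, A] f p x =
    (\int[mu]_(y in `]-oo, A]) (trunc_ratio f C x y * p y) * f x)%:E.
  rewrite scaled_trunc_integral//; apply: eq_integral => y.
  rewrite inE/= in_itv/= => yA; rewrite /trunc_ratio min_l.
    by rewrite mulrCA divff ?gt_eqF// mulr1.
  by rewrite ler_pdivrMr// fCx.
by rewrite lee_fin ler_wpM2r// ltW.
Unshelve. all: by end_near. Qed.

End long_tails.

(** * Splitting the convolution *)

Notation middle A x := (`]A, (x - A)%R[%classic).

Section splitting.
Context {R : realType}.
Implicit Types (f g h p : R -> R) (A B c d e x : R).
Local Notation mu := (@lebesgue_measure R).

Lemma conv_split f g A x : measurable_fun setT f -> measurable_fun setT g ->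
  (forall y, 0 <= f y) -> (forall y, 0 <= g y) -> A * 2 < x ->
  (convE setT f g x = convE `]-oo, A] f g x + convE (middle A x) f g x +
                      convE `]-oo, A] g f x)%E.
Proof.
move=> mf mg f0 g0 Ax.
rewrite -(convEC x (measurable_itv _) mf mg f0 g0).
have -> : (fun y : R => x - y) @^-1` `]-oo, A] = `[x - A, +oo[%classic.
  by apply/seteqP; split => y /=; rewrite !in_itv/= ?andbT; lra.
have -> : [set: R] = `]-oo, A] `|` middle A x `|` `[x - A, +oo[%classic.
  apply/esym; rewrite -subTset => y _ /=; rewrite !in_itv/= andbT.
  have [yA|yA] := leP y A; first by left; left.
  by have [xy|xy] := leP (x - A) y; [right|left; right].
have mi (D : set R) : measurable_fun D (fun y : R => (f (x - y) * g y)%:E).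
  exact: measurable_conv_integrand.
have i0 y : (0 <= (f (x - y) * g y)%:E)%E by rewrite lee_fin mulr_ge0.
rewrite /convE ge0_integral_setU//; last 3 first.
- exact: (@measurableU _ (measurableTypeR R)).
- exact: mi.
- rewrite disj_set2E; apply/eqP; rewrite -subset0 => y /=.
  by rewrite !in_itv/= andbT => -[[|]]; lra.
rewrite ge0_integral_setU//; first exact: mi.
rewrite disj_set2E; apply/eqP; rewrite -subset0 => y /=.
by rewrite !in_itv/= => -[]; lra.
Qed.

Lemma convE_scale_le f g f' g' (D D' : set R) k x : measurable D -> measurable D' ->
  D `<=` D' -> 0 <= k ->
  measurable_fun setT f -> measurable_fun setT g ->
  measurable_fun setT f' -> measurable_fun setT g' ->
  (forall y, 0 <= f y) -> (forall y, 0 <= g y) ->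
  (forall y, 0 <= f' y) -> (forall y, 0 <= g' y) ->
  (forall y, D y -> f (x - y) * g y <= k * (f' (x - y) * g' y)) ->
  (convE D f g x <= k%:E * convE D' f' g' x)%E.
Proof.
move=> mD mD' DD' k0 mf mg mf' mg' f0 g0 f'0 g'0 H.
have i0 y : (0 <= (f' (x - y) * g' y)%:E)%E by rewrite lee_fin mulr_ge0.
apply: (@le_trans _ _ (k%:E * convE D f' g' x)%E); last first.
  rewrite lee_wpmul2l ?lee_fin//; apply: ge0_subset_integral => //.
  exact: measurable_conv_integrand.
rewrite -ge0_integralZl//; last exact: measurable_conv_integrand.
apply: ge0_le_integral => //.
- by move=> y _; rewrite lee_fin mulr_ge0.
- exact: measurable_conv_integrand.
- by apply: measurable_funeM; exact: measurable_conv_integrand.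
Qed.

Lemma conv_middle_le f g f' g' A B c d x : A <= B -> 0 <= c -> 0 <= d ->
  measurable_fun setT f -> measurable_fun setT g ->
  measurable_fun setT f' -> measurable_fun setT g' ->
  (forall y, 0 <= f y) -> (forall y, 0 <= g y) ->
  (forall y, 0 <= f' y) -> (forall y, 0 <= g' y) ->
  (forall y, B < y -> f y <= c * f' y) ->
  (forall y, B < y -> g y <= d * g' y) ->
  (convE (middle B x) f g x <= (c * d)%:E * convE (middle A x) f' g' x)%E.
Proof.
move=> AB c0 d0 mf mg mf' mg' f0 g0 f'0 g'0 fc gd.
apply: convE_scale_le => //.
- by move=> y /=; rewrite !in_itv/=; lra.
- exact: mulr_ge0.
- move=> y /=; rewrite in_itv/= => /andP[By yB].
  by rewrite mulrACA ler_pM// ?fc ?gd//; lra.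
Qed.

End splitting.

(** * Asymptotic equivalence *)

Section asymptotic_equivalence.
Context {R : realType}.
Implicit Types (a b f g h p : R -> R) (A B c d e x : R).

Lemma asymp_equivP a b : (\forall x \near +oo, 0 < b x) ->
  asymp_equiv a b <->
  forall e, 0 < e ->
    \forall x \near +oo, (1 - e) * b x <= a x <= (1 + e) * b x.
Proof.
move=> b0; split=> [/cvgrPdist_le ab e e0|H].
  near=> x.
  have bx : 0 < b x by near: x.
  have : `|1 - a x / b x| <= e by near: x; exact: ab.
  rewrite distrC ler_distl ler_pdivlMr// ler_pdivrMr//.
apply/cvgrPdist_le => e e0; near=> x.
have bx : 0 < b x by near: x.
have : (1 - e) * b x <= a x <= (1 + e) * b x by near: x; exact: H.
rewrite distrC ler_distl ler_pdivlMr// ler_pdivrMr//.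
Unshelve. all: by end_near. Qed.

Lemma asymp_equiv_sym a b : asymp_equiv a b -> asymp_equiv b a.
Proof.
move=> ab; rewrite /asymp_equiv -[X in _ --> X]invr1.
under eq_fun do rewrite -invf_div.
by apply: cvgV => //; exact: oner_neq0.
Qed.

(** Write [h (x - y) / h x] as
    [(h (x - y) / f (x - y)) * (f (x - y) / f x) * (f x / h x)]. *)
Lemma asymp_equiv_long_tailed f h : long_tailed f -> asymp_equiv h f ->
  measurable_fun setT h -> (forall x, 0 <= h x) -> long_tailed h.
Proof.
move=> fL hf mh h0; have [_ _ fl] := fL; split => // y.
have hfy : h (x - y) / f (x - y) @[x --> +oo] --> (1 : R).
  by apply: (@cvg_comp _ _ _ (fun x => x - y) (fun x => h x / f x) _ _ _ _ hf); exact: cvg_addrr.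
have lim1 : h (x - y) / f (x - y) * (f (x - y) / f x) * (f x / h x)
    @[x --> +oo] --> (1 * 1 * 1 : R).
  by apply: cvgM (asymp_equiv_sym hf); apply: cvgM (fl y).
rewrite !mulr1 in lim1; apply: (cvg_trans _ lim1).
apply: near_eq_cvg; near=> x.
have fx : 0 < f x by near: x; exact: long_tailed_gt0.
have fxy : 0 < f (x - y).
  near: x; have := long_tailed_gt0 fL.
  move=> [M [Mr HM]]; exists (M + y); split; first by rewrite num_real.
  by move=> z Mz; apply: HM; rewrite ltrBrDr.
by rewrite /= !mulrA !divfK ?gt_eqF.
Unshelve. all: by end_near. Qed.

Lemma asymp_equiv_almost_decreasing f h : long_tailed f ->
  almost_decreasing f -> asymp_equiv h f -> (forall x, 0 <= h x) ->
  almost_decreasing h.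
Proof.
move=> fL [f0 [x0 [K [x00 K0 fK]]]] hf h0; split => //.
have [M [_ HM]] : \forall x \near +oo, (1 - 2^-1) * f x <= h x <= (1 + 2^-1) * f x.
  by apply: (asymp_equivP _ (long_tailed_gt0 fL)).1 => //; lra.
(* [h (x + y) <= 3/2 * f (x + y) <= 3/2 * K * f x <= 3 * K * h x]. *)
exists (Num.max x0 M), (3 * K); split.
- by rewrite lt_max x00.
- lra.
- move=> x y; rewrite gt_max => /andP[x0x Mx] y0.
  have /andP[_ h1] := HM (x + y) ltac:(lra).
  have /andP[h2 _] := HM x Mx.
  have := fK x y x0x y0; nra.
Qed.

(** The upper bound on the extended-real integral forces its finiteness, which
    makes it agree with the real-valued convolution. *)
Lemma convolution_asymp f g b : (\forall x \near +oo, 0 < b x) ->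
  (forall e, 0 < e -> \forall x \near +oo,
     (((1 - e) * b x)%:E <= convE setT f g x <= ((1 + e) * b x)%:E)%E) ->
  asymp_equiv (convolution f g) b.
Proof.
move=> b0 H; apply/asymp_equivP => // e e0; apply: filterS (H e e0) => x.
rewrite -[convolution f g x]/(fine (convE setT f g x)).
by case: (convE setT f g x) => [r| |] /andP[h1 h2]//; rewrite -!lee_fin h1 h2.
Qed.

(** A divergent integral would give the convolution the value [0]. *)
Lemma convolution_neq0 f g x : convolution f g x != 0 ->
  (convE setT f g x = (convolution f g x)%:E)%E.
Proof.
rewrite -[convolution f g x]/(fine (convE setT f g x)).
by case: (convE setT f g x) => //=; rewrite eqxx.
Qed.

End asymptotic_equivalence.

(** * Subexponentiality and the middle piece *)

Section subexponential.
Context {R : realType}.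
Implicit Types (f g h p q : R -> R) (A B c d e x : R).
Local Notation mu := (@lebesgue_measure R).

(** The reference [b] is kept separate from [f] and [g] because the middle
    piece of [f * g] gets compared with [f * g] itself as well as with [f]. *)
Definition negligible_middle f g b := forall e, 0 < e ->
  exists A, \forall x \near +oo, (convE (middle A x) f g x <= (e * b x)%:E)%E.

Lemma density_conv_ge f p e : long_tailed f -> prob_density p -> 0 < e ->
  exists A0, forall A, A0 <= A -> \forall x \near +oo,
    (((1 - e) * f x)%:E <= convE `]-oo, A] f p x)%E.
Proof.
move=> fL dp e0; have [A0 HA] := density_mass_near1 dp e0; have [mp p0 _] := dp.
exists A0 => A AA; apply: long_tailed_conv_ge => //; last exact: HA.
exact: density_integrable.
Qed.

Lemma density_conv_le f p A e : long_tailed f -> almost_decreasing f ->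
  prob_density p -> 0 < e -> \forall x \near +oo,
    (convE `]-oo, A] f p x <= ((1 + e) * f x)%:E)%E.
Proof.
move=> fL fD dp e0; apply: long_tailed_conv_le => //.
apply: (@le_lt_trans _ _ 1%:E); first exact: density_mass_le1.
by rewrite lte_fin; lra.
Qed.

(** The two outer pieces of [h * h] already account for almost all of
    [2 * h x], by the lower bound that needs long-tailedness alone. *)
Lemma subexponential_middle h : subexponential h -> negligible_middle h h h.
Proof.
move=> [dh hL hh] e e0; have [mh h0 _] := dh.
have d0 : 0 < e / 4 by lra.
(* [h * h] exceeds [2 * h x] by at most [e / 2 * h x], and each outer piece
   falls short of [h x] by at most [e / 4 * h x]. *)
have [A HA] := density_conv_ge hL dh d0; exists A.
near=> x.
have hx : 0 < h x by near: x; exact: long_tailed_gt0.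
have Px : (((1 - e / 4) * h x)%:E <= convE `]-oo, A] h h x)%E.
  by near: x; exact: HA.
have Ax : A * 2 < x by near: x; exact: near_gt.
have : (1 - e / 4) * (2 * h x) <= convolution h h x <= (1 + e / 4) * (2 * h x).
  near: x; apply: (asymp_equivP _ _).1 => //.
  by apply: filterS (long_tailed_gt0 hL) => x; lra.
have : convolution h h x != 0.
  have : convolution h h x / (2 * h x) != 0.
    by near: x; exact: (cvgr_neq0 _ hh (oner_neq0 R)).
  by apply: contra_neq => ->; rewrite mul0r.
move=> /convolution_neq0.
rewrite (conv_split mh mh h0 h0 Ax).
move: Px (convE_ge0 (middle A x) x h0 h0).
case: (convE _ _ _ x) => [P| |]//; case: (convE _ _ _ x) => [M| |]//=.
rewrite -!EFinD !lee_fin => Px M0 [<-]; nra.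
Unshelve. all: by end_near. Qed.

(** The outer pieces of [f * f] are both close to [f x] from above as well, by
    almost decrease, so nothing but the middle piece could spoil
    [f * f ~ 2 * f]. *)
Lemma middle_subexponential f : prob_density f -> long_tailed f ->
  almost_decreasing f -> negligible_middle f f f -> subexponential f.
Proof.
move=> df fL fD fm; have [mf f0 _] := df; split => //.
have pos2 : \forall x \near +oo, 0 < 2 * f x.
  by apply: filterS (long_tailed_gt0 fL) => x; lra.
apply: convolution_asymp => // e e0.
have d0 : 0 < e / 2 by lra.
have [A HA] := density_conv_ge fL df e0.
have [B HB] := fm e e0.
near=> x; apply/andP; split.
- have Ax : A * 2 < x by near: x; exact: near_gt.
  rewrite (conv_split mf mf f0 f0 Ax).
  have Px : (((1 - e) * f x)%:E <= convE `]-oo, A] f f x)%E.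
    by near: x; exact: HA.
  rewrite (_ : _ * _ = (1 - e) * f x + 0 + (1 - e) * f x); last ring.
  by rewrite !EFinD; apply: leeD => //; apply: leeD => //; exact: convE_ge0.
- have Bx : B * 2 < x by near: x; exact: near_gt.
  rewrite (conv_split mf mf f0 f0 Bx).
  have Px : (convE `]-oo, B] f f x <= ((1 + e / 2) * f x)%:E)%E.
    by near: x; exact: density_conv_le.
  have Mx : (convE (middle B x) f f x <= (e * f x)%:E)%E by near: x.
  rewrite (_ : (1 + e) * _ = (1 + e / 2) * f x + e * f x + (1 + e / 2) * f x); last by field.
  by rewrite !EFinD; apply: leeD => //; apply: leeD.
Unshelve. all: by end_near. Qed.

End subexponential.

(** * Comparison of middle pieces *)

Section negligible.
Context {R : realType}.
Implicit Types (b f g h p : R -> R) (A B c d e k x : R).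
Local Notation mu := (@lebesgue_measure R).

Lemma littleo_le f g e : (forall x, 0 <= f x) -> (forall x, 0 <= g x) ->
  g =o_+oo f -> 0 < e -> \forall x \near +oo, g x <= e * f x.
Proof.
move=> f0 g0 /eqoP gf e0; apply: filterS (gf e e0) => x.
by rewrite !ger0_norm.
Qed.

(** For [A] past the points where the bounds start, both [y] and [x - y] are in
    the range of these bounds throughout the middle interval. *)
Lemma negligible_middle_dom f g b f' g' b' c d k :
  negligible_middle f' g' b' -> 0 < c -> 0 < d -> 0 < k ->
  measurable_fun setT f -> measurable_fun setT g ->
  measurable_fun setT f' -> measurable_fun setT g' ->
  (forall y, 0 <= f y) -> (forall y, 0 <= g y) ->
  (forall y, 0 <= f' y) -> (forall y, 0 <= g' y) ->
  (\forall x \near +oo, f x <= c * f' x) ->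
  (\forall x \near +oo, g x <= d * g' x) ->
  (\forall x \near +oo, b' x <= k * b x) ->
  negligible_middle f g b.
Proof.
move=> mid c0 d0 k0 mf mg mf' mg' f0 g0 f'0 g'0 [M [_ fM]] [N [_ gN]] bk e e0.
have cd0 : 0 < c * d by rewrite mulr_gt0.
have cdk0 : 0 < c * d * k by rewrite mulr_gt0.
have [A HA] := mid _ (divr_gt0 e0 cdk0).
exists (Num.max A (Num.max M N)); near=> x.
have mx : (convE (middle A x) f' g' x <= (e / (c * d * k) * b' x)%:E)%E.
  by near: x.
have bx : b' x <= k * b x by near: x.
apply: (le_trans (conv_middle_le (A := A) (f' := f') (g' := g') x _ (ltW c0)
  (ltW d0) _ _ _ _ _ _ _ _ _ _)) => //.
- by rewrite le_max lexx.
- by move=> y; rewrite !gt_max => /and3P[_ /fM].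
- by move=> y; rewrite !gt_max => /and3P[_ _ /gN].
apply: (@le_trans _ _ ((c * d)%:E * (e / (c * d * k) * b' x)%:E)%E).
  by rewrite lee_wpmul2l// lee_fin ltW.
rewrite -EFinM lee_fin.
apply: (@le_trans _ _ ((c * d) * (e / (c * d * k) * (k * b x)))).
  by rewrite ler_wpM2l ?(ltW cd0)// ler_wpM2l// divr_ge0// ltW.
by rewrite le_eqVlt; apply/orP; left; apply/eqP; field; rewrite !gt_eqF.
Unshelve. all: by end_near. Qed.

(** The middle pieces of [p * p] and [q * q] dominate each other up to
    constants; almost decrease of [q] recovers its subexponentiality from the
    middle piece. *)
Lemma asymp_equiv_subexponential p q : subexponential p -> prob_density q ->
  long_tailed q -> almost_decreasing q -> asymp_equiv q p -> subexponential q.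
Proof.
move=> pS dq qL qD qp; have [dp pL _] := pS.
have [[mp p0 _] [mq q0 _]] := (dp, dq).
have le2 a b : long_tailed b -> asymp_equiv a b ->
    \forall x \near +oo, a x <= 2 * b x.
  move=> bL /(asymp_equivP _ (long_tailed_gt0 bL)).1/(_ 1 ltr01).
  by apply: filterS => x /andP[_].
have qp2 := le2 _ _ pL qp.
apply: middle_subexponential => //.
apply: (negligible_middle_dom (subexponential_middle pS) _ _ _ mq mq mp mp q0 q0
  p0 p0 qp2 qp2 (le2 _ _ qL (asymp_equiv_sym qp))); exact: ltr0n.
Qed.

Lemma convE_le_bound (D : set R) f p c x : measurable D ->
  measurable_fun setT f -> measurable_fun setT p ->
  (forall y, 0 <= f y) -> (forall y, 0 <= p y) -> 0 <= c ->
  (forall y, D y -> f (x - y) <= c) ->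
  (convE D f p x <= c%:E * \int[mu]_(y in D) (p y)%:E)%E.
Proof.
move=> mD mf mp f0 p0 c0 fc.
have mpD : measurable_fun D (fun y => (p y)%:E).
  exact/measurable_EFinP/measurable_funTS.
rewrite -ge0_integralZl//; last by move=> y _; rewrite lee_fin.
apply: ge0_le_integral => //.
- by move=> y _; rewrite lee_fin mulr_ge0.
- exact: measurable_conv_integrand.
- exact: measurable_funeM.
- by move=> y Dy; rewrite -EFinM lee_fin ler_wpM2r// fc.
Qed.

Lemma density_tail_small p e : prob_density p -> 0 < e ->
  exists A0, forall A, A0 <= A ->
    (\int[mu]_(y in `]A, +oo[) (p y)%:E <= e%:E)%E.
Proof.
move=> dp e0; have [A0 HA] := density_mass_near1 dp e0; exists A0 => A /HA.
have [mp p0 p1] := dp; move: p1.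
rewrite (_ : setT = `]-oo, A] `|` `]A, +oo[%classic); last first.
  apply/esym; rewrite -subTset => y _ /=; rewrite !in_itv/= andbT.
  by have [yA|yA] := leP y A; [left|right].
rewrite ge0_integral_setU//; last 3 first.
- exact/measurable_EFinP/measurable_funTS.
- by move=> y _; rewrite lee_fin.
- rewrite disj_set2E; apply/eqP; rewrite -subset0 => y /=.
  by rewrite !in_itv/= andbT; lra.
have : (0 <= \int[mu]_(y in `]A, +oo[) (p y)%:E)%E.
  by apply: integral_ge0 => y _; rewrite lee_fin.
case: (integral _ _ _) => [t| |]//; case: (integral _ _ _) => [s| |]//= _.
by rewrite -EFinD lte_fin lee_fin => -[]; lra.
Qed.

End negligible.

(** * Convolution with a density of smaller order *)

Section convolution_of_long_tailed.
Context {R : realType} (f g : R -> R).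
Hypotheses (df : prob_density f) (dg : prob_density g).
Hypotheses (fL : long_tailed f) (fD : almost_decreasing f) (gf : g =o_+oo f).
Local Notation mu := (@lebesgue_measure R).
Implicit Types (A e x : R).

Let mf : measurable_fun setT f. Proof. by case: df. Qed.
Let mg : measurable_fun setT g. Proof. by case: dg. Qed.
Let f0 : forall x, 0 <= f x. Proof. by case: df. Qed.
Let g0 : forall x, 0 <= g x. Proof. by case: dg. Qed.

Lemma conv_ge_left e : 0 < e ->
  \forall x \near +oo, (((1 - e) * f x)%:E <= convE setT f g x)%E.
Proof.
move=> e0; apply: long_tailed_conv_ge => //; first exact: density_integrable.
by case: dg => _ _ ->; rewrite lte_fin; lra.
Qed.

(** The third piece of the splitting costs only [o(f)]: there [g] is evaluated
    far to the right, and the corresponding piece of [f * f] is [O(f)]. *)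
Lemma conv_le_left_middle A e : 0 < e -> \forall x \near +oo,
  (convE setT f g x <= ((1 + e) * f x)%:E + convE (middle A x) f g x)%E.
Proof.
move=> e0; have e2 : 0 < e / 2 by lra.
have e4 : 0 < e / 4 by lra.
have [M [_ HM]] := littleo_le f0 g0 gf e4.
near=> x.
have Ax : A * 2 < x by near: x; exact: near_gt.
have Mx : M + A < x by near: x; exact: near_gt.
rewrite (conv_split mf mg f0 g0 Ax).
have P1 : (convE `]-oo, A] f g x <= ((1 + e / 2) * f x)%:E)%E.
  by near: x; exact: density_conv_le.
have P2 : (convE `]-oo, A] f f x <= ((1 + 1) * f x)%:E)%E.
  by near: x; exact: density_conv_le.
have P3 : (convE `]-oo, A] g f x <= (e / 4)%:E * convE `]-oo, A] f f x)%E.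
  apply: convE_scale_le => //; first exact: ltW.
  move=> y /=; rewrite in_itv/= => yA; rewrite mulrA ler_wpM2r//.
  by apply: HM; lra.
have P4 : (convE `]-oo, A] g f x <= (e / 2 * f x)%:E)%E.
  apply: (le_trans P3).
  rewrite (_ : e / 2 * f x = e / 4 * ((1 + 1) * f x)); last by field.
  by rewrite [leRHS]EFinM lee_wpmul2l// lee_fin ltW.
rewrite (_ : (1 + e) * f x = (1 + e / 2) * f x + e / 2 * f x); last by field.
by rewrite EFinD addeAC; apply: leeD => //; apply: leeD.
Unshelve. all: by end_near. Qed.

Lemma negligible_middle_asymp : negligible_middle f g f ->
  asymp_equiv (convolution f g) f.
Proof.
move=> fgm; apply: convolution_asymp; first exact: long_tailed_gt0.
move=> e e0; have e2 : 0 < e / 2 by lra.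
have [A HA] := fgm _ e2.
near=> x; apply/andP; split; first by near: x; exact: conv_ge_left.
have m1 : (convE setT f g x <=
    ((1 + e / 2) * f x)%:E + convE (middle A x) f g x)%E.
  by near: x; exact: conv_le_left_middle.
have m2 : (convE (middle A x) f g x <= (e / 2 * f x)%:E)%E by near: x.
rewrite (_ : (1 + e) * f x = (1 + e / 2) * f x + e / 2 * f x); last by field.
by rewrite EFinD; apply: (le_trans m1); exact: leeD.
Unshelve. all: by end_near. Qed.

Let g_le_f : \forall x \near +oo, g x <= 1 * f x.
Proof. exact: littleo_le. Qed.

Let le_mul1 (b : R -> R) : \forall x \near +oo, b x <= 1 * b x.
Proof. by near=> x; rewrite mul1r.
Unshelve. all: by end_near. Qed.

(** Here [f * g ~ f], and [f * g] inherits from [f] both long-tailedness and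
    the almost decrease that [asymp_equiv_subexponential] relies on. *)
Lemma subexponential_conv : subexponential f -> subexponential (convolution f g).
Proof.
move=> fS; have [mh h0 _] := convolution_density df dg.
have hf : asymp_equiv (convolution f g) f.
  apply: negligible_middle_asymp.
  exact: (negligible_middle_dom (subexponential_middle fS) _ _ _ mf mg mf mf f0
    g0 f0 f0 (le_mul1 f) g_le_f (le_mul1 f)).
have hL := asymp_equiv_long_tailed fL hf mh h0.
have hD := asymp_equiv_almost_decreasing fL fD hf h0.
exact: asymp_equiv_subexponential fS (convolution_density df dg) hL hD hf.
Qed.

(** A bootstrap: [f <= 2 * h] makes the middle piece of [f * g] small relative
    to [h = f * g]; absorbing it gives [h <= 3 * f], so the same piece is small
    relative to [f], and [h ~ f]. *)
Lemma subexponential_of_conv : subexponential (convolution f g) -> subexponential f.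
Proof.
move=> hS; have [dh hL _] := hS; have [mh h0 _] := dh.
set h := convolution f g in hS dh hL mh h0 *.
have hE : \forall x \near +oo, convE setT f g x = (h x)%:E.
  apply: filterS (long_tailed_gt0 hL) => x hx.
  by apply: convolution_neq0; rewrite gt_eqF.
have half : 0 < (2^-1 : R) by lra.
have fh : \forall x \near +oo, f x <= 2 * h x.
  near=> x.
  have : (((1 - 2^-1) * f x)%:E <= convE setT f g x)%E.
    by near: x; exact: conv_ge_left.
  have -> : convE setT f g x = (h x)%:E by near: x.
  by rewrite lee_fin; lra.
have gh : \forall x \near +oo, g x <= 2 * h x.
  near=> x.
  have : g x <= 1 * f x by near: x.
  have : f x <= 2 * h x by near: x.
  by lra.
have fgm : negligible_middle f g h.
  exact: (negligible_middle_dom (subexponential_middle hS) _ _ _ mf mg mh mh f0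
    g0 h0 h0 fh gh (le_mul1 h)).
(* Half of [h x] is absorbed: [h <= 3/2 * f + h/2]. *)
have [A HA] := fgm _ half.
have hf3 : \forall x \near +oo, h x <= 3 * f x.
  near=> x.
  have : (convE setT f g x <=
      ((1 + 2^-1) * f x)%:E + convE (middle A x) f g x)%E.
    by near: x; exact: conv_le_left_middle.
  have -> : convE setT f g x = (h x)%:E by near: x.
  have mx : (convE (middle A x) f g x <= (2^-1 * h x)%:E)%E by near: x.
  move=> /le_trans/(_ (leeD (lexx _) mx)).
  by rewrite -EFinD lee_fin; lra.
have hf : asymp_equiv h f.
  apply: negligible_middle_asymp.
  exact: (negligible_middle_dom fgm _ _ _ mf mg mf mg f0 g0 f0 g0
    (le_mul1 f) (le_mul1 g) hf3).
exact: asymp_equiv_subexponential hS df fL fD (asymp_equiv_sym hf).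
Unshelve. all: by end_near. Qed.

(** Between [A] and [a x] insensitivity gives [f (x - y) <= 2 * f x], so only
    the small tail mass of [g] beyond [A] counts; symmetrically between
    [x - a x] and [x - A], after reflection and [g <= f], with the tail mass of
    [f].  The remaining piece is the one assumed to be [o(f)]. *)
Lemma insensitive_negligible_middle (a : R -> R) :
  (forall x, 0 < x -> a x < x / 2) -> a x @[x --> +oo] --> +oo ->
  insensitive a f ->
  (fun x => \int[mu]_(y in `[a x, x - a x]) (f (x - y) * g y) : R) =o_+oo f ->
  negligible_middle f g f.
Proof.
(* The three pieces take [2/5], [1/5] and [2/5] of [e * f x]. *)
move=> ax2 aoo insf mido e e0; have d0 : 0 < e / 5 by lra.
have [Af HAf] := density_tail_small df d0.
have [Ag HAg] := density_tail_small dg d0.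
pose A := Num.max Af Ag; exists A.
have tailf : (\int[mu]_(y in `]A, +oo[) (f y)%:E <= (e / 5)%:E)%E.
  by apply: HAf; rewrite le_max lexx.
have tailg : (\int[mu]_(y in `]A, +oo[) (g y)%:E <= (e / 5)%:E)%E.
  by apply: HAg; rewrite le_max lexx orbT.
have [_ [x0 [K [x00 K0 fK]]]] := fD.
have [M [_ HM]] := g_le_f.
near=> x.
have xpos : 0 < x by near: x; exact: near_gt.
have ax : a x < x / 2 by exact: ax2.
have Ax : A < a x by near: x; exact: (cvgry_gt aoo).
have NAx : - A < a x by near: x; exact: (cvgry_gt aoo).
have x0x : x0 + 1 < a x by near: x; exact: (cvgry_gt aoo).
have Mx : M * 2 < x by near: x; exact: near_gt.
have insx : (ereal_sup [set (`|(f (x + y) - f x)%R|%R)%:E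
    | y in [set y : R | (`|y| <= a x)%R]] <= (1 * f x)%:E)%E.
  by near: x; exact: insf.
have mx : `|\int[mu]_(y in `[a x, x - a x]) (f (x - y) * g y)| <= e / 5 * `|f x|.
  by near: x; move/eqoP : mido; apply.
have near2 y : A < y -> y < a x -> f (x - y) <= 2 * f x.
  move=> Ay ya; suff : `|f (x - y) - f x| <= 1 * f x by rewrite ler_distl; lra.
  rewrite -lee_fin; apply: le_trans insx; apply: ereal_sup_ubound.
  by exists (- y) => //=; rewrite normrN ler_norml; lra.
have bound p : prob_density p ->
    (\int[mu]_(y in `]A, +oo[) (p y)%:E <= (e / 5)%:E)%E ->
    (convE `]A, a x[ f p x <= (2 * f x * (e / 5))%:E)%E.
  move=> dp tailp; have [mp p0 _] := dp.
  apply: (@le_trans _ _ ((2 * f x)%:E * \int[mu]_(y in `]A, a x[) (p y)%:E)%E).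
    apply: convE_le_bound => //; first by rewrite mulr_ge0.
    by move=> y /=; rewrite in_itv/= => /andP[]; exact: near2.
  rewrite [leRHS]EFinM lee_wpmul2l//; first by rewrite lee_fin mulr_ge0.
  apply: le_trans tailp; apply: ge0_subset_integral => //.
  - exact/measurable_EFinP/measurable_funTS.
  - by move=> y _; rewrite lee_fin.
  - by move=> y /=; rewrite !in_itv/= andbT => /andP[].
have left_part := bound _ dg tailg.
have right_part : (convE `](x - a x)%R, (x - A)%R[ f g x <= (2 * f x * (e / 5))%:E)%E.
  have -> : `]x - a x, x - A[%classic = (fun y : R => x - y) @^-1` `]A, a x[.
    by apply/seteqP; split => y /=; rewrite !in_itv/=; lra.
  rewrite (convEC x (measurable_itv _) mf mg f0 g0).
  apply: le_trans (bound _ df tailf); rewrite -[leRHS]mul1e.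
  apply: convE_scale_le => // y /=; rewrite in_itv/= => /andP[_ ya].
  by rewrite mulrA ler_wpM2r//; apply: HM; lra.
(* Almost decrease bounds [f] on a right half-line, so this integral is
   finite and the hypothesis on its real value bounds it. *)
have central_part : (convE `[a x, (x - a x)%R] f g x <= (e / 5 * f x)%:E)%E.
  have c0 : 0 <= K * f (x0 + 1) by rewrite mulr_ge0// ltW.
  have fc y : `[a x, x - a x]%classic y -> f (x - y) <= K * f (x0 + 1).
    rewrite /= in_itv/= => /andP[ay ya].
    by rewrite (_ : x - y = x0 + 1 + (x - y - (x0 + 1))); [apply: fK; lra|ring].
  have fin : (convE `[a x, (x - a x)%R] f g x < +oo)%E.
    apply: (le_lt_trans (convE_le_bound (measurable_itv _) mf mg f0 g0 c0 fc)).
    apply: (@le_lt_trans _ _ ((K * f (x0 + 1))%:E * 1)%E); last by rewrite mule1 ltry.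
    by rewrite lee_wpmul2l ?lee_fin//; exact: density_mass_le1.
  have pos := convE_ge0 `[a x, x - a x] x f0 g0.
  rewrite -[leLHS]fineK ?ge0_fin_numE// lee_fin -[X in _ <= _ * X]ger0_norm//.
  exact: le_trans (ler_norm _) mx.
have -> : middle A x = `]A, a x[ `|` `[a x, x - a x] `|` `]x - a x, x - A[%classic.
  apply/seteqP; split => y /=; rewrite !in_itv/=; last by case=> [[]|]; lra.
  move=> /andP[Ay yA]; have [ya|ay] := ltP y (a x); first by left; left; rewrite Ay.
  by have [yx|xy] := leP y (x - a x); [left; right|right].
have mi (D : set R) : measurable_fun D (fun y : R => (f (x - y) * g y)%:E).
  exact: measurable_conv_integrand.
have i0 y : (0 <= (f (x - y) * g y)%:E)%E by rewrite lee_fin mulr_ge0.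
rewrite /convE ge0_integral_setU//; last 3 first.
- exact: (@measurableU _ (measurableTypeR R)).
- exact: mi.
- rewrite disj_set2E; apply/eqP; rewrite -subset0 => y /=.
  by rewrite !in_itv/= => -[[|]]; lra.
rewrite ge0_integral_setU//; last 2 first.
- exact: mi.
- rewrite disj_set2E; apply/eqP; rewrite -subset0 => y /=.
  by rewrite !in_itv/= => -[]; lra.
rewrite (_ : e * f x = 2 * f x * (e / 5) + e / 5 * f x + 2 * f x * (e / 5)); last by field.
by rewrite 2!EFinD; apply: leeD => //; exact: leeD.
Unshelve. all: by end_near. Qed.

End convolution_of_long_tailed.

Theorem lemma2p6 (R : realType) (f g : R -> R)
    (hf : prob_density f) (hg : prob_density g)
    (hfL : long_tailed f) (hfD : almost_decreasing f)
    (hgf : g =o_+oo f) :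
  (subexponential f <-> subexponential (convolution f g)) /\
  (forall a : R -> R,
     (forall x : R, 0 < x -> a x < x / 2) ->
     a x @[x --> +oo] --> +oo ->
     insensitive a f ->
     (fun x : R =>
        \int[lebesgue_measure]_(y in `[a x, x - a x]) (f (x - y) * g y) : R)
       =o_+oo f ->
     ((long_tailed f /\ ~ subexponential f) <->
      (long_tailed (convolution f g) /\ ~ subexponential (convolution f g)))).
Proof.
have fS : subexponential f <-> subexponential (convolution f g).
  by split; [exact: subexponential_conv|exact: subexponential_of_conv].
split=> // a ax2 aoo insf mido; rewrite fS; split=> -[_ nS]; split=> //.
have [mh h0 _] := convolution_density hf hg.
apply: (asymp_equiv_long_tailed hfL _ mh h0).
apply: negligible_middle_asymp => //.
exact: insensitive_negligible_middle insf mido.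
Qed.
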